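(* Let $A$ be an integral domain whose fraction field $\mathcal{K}(A)$ is formally real, and let $f\in A$. If $f\geq 0$ on $\operatorname{Spec}_rA$, then $f\in\mathcal{C}^0$, where $\mathcal{C}^0=A\cap\sum\mathcal{K}^0(\operatorname{Spec}_cA)^2$ is the set of elements of $A$ that are sums of squares of rational continuous functions on $\operatorname{Spec}_cA$.
   Context: All rings are commutative and contain $\mathbb{Q}$. A cone of a ring $B$ is a subset $P\subset B$ with $P+P\subset P$, $P\cdot P\subset P$ and $b^2\in P$ for all $b\in B$; it is proper if $-1\notin P$. An ordering of $B$ is a proper cone $P$ such that $ab\in P$ implies $a\in P$ or $-b\in P$; $\operatorname{Spec}_rB$ is the set of orderings of $B$. For $\alpha\in\operatorname{Spec}_rA$, $P_\alpha$ is the corresponding cone, $\operatorname{supp}(\alpha)=P_\alpha\cap -P_\alpha$ (a prime ideal), and $R_\alpha$ is the real closure of the residue field $k(\operatorname{supp}(\alpha))$ for the ordering induced by $\alpha$. For $a\in A$, $a(\alpha)\in R_\alpha$ is the image of $a$; thus $a(\alpha)\geq 0$ iff $a\in P_\alpha$ and $a(\alpha)=0$ iff $a\in\operatorname{supp}(\alpha)$. $\operatorname{Spec}_rA$ has the topology generated by the sets $\{\alpha\mid f_1(\alpha)>0,\ldots,f_k(\alpha)>0\}$. The map $Q\mapsto Q\cap A$ identifies $\operatorname{Spec}_r\mathcal{K}(A)$ with the set of orderings of $A$ with support $(0)$; $\operatorname{Spec}_cA:=\overline{\operatorname{Spec}_r\mathcal{K}(A)}$ (closure in $\operatorname{Spec}_rA$).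 One says $\beta$ specializes to $\alpha$, written $\beta\to\alpha$, if $\alpha\in\overline{\{\beta\}}$. To such a specialization is associated the valuation ring $W_{\beta\alpha}\subset R_\beta$, the convex hull in $R_\beta$ of the image of $A_{\operatorname{supp}(\alpha)}$, i.e. $W_{\beta\alpha}=\{z\in R_\beta\mid |z|\leq a(\beta)/s(\beta)\text{ for some }a\in A,\ s\in A\setminus\operatorname{supp}(\alpha)\}$, with its place $\lambda_{\beta\alpha}$ from $W_{\beta\alpha}$ to its (real closed) residue field, which contains $R_\alpha$ via $a(\alpha)\mapsto\lambda_{\beta\alpha}(a(\beta))$ for $a\in A$. An abstract semialgebraic function $g$ on $\operatorname{Spec}_cA$ assigns to each $\alpha\in\operatorname{Spec}_cA$ an element $g(\alpha)\in R_\alpha$ defined by one first-order formula (in the language of ordered fields) with parameters in $A$, uniformly in $\alpha$. It is continuous on $\operatorname{Spec}_cA$ if for every specialization $\beta\to\alpha$ in $\operatorname{Spec}_cA$ one has $g(\beta)\in W_{\beta\alpha}$ and $\lambda_{\beta\alpha}(g(\beta))=g(\alpha)$. It is rational continuous if it is continuous and there exist $p\in A$, $q\in A\setminus\{0\}$ with $g(\alpha)=p(\alpha)/q(\alpha)$ for all $\alpha\in\operatorname{Spec}_cA$ with $q(\alpha)\neq 0$. $\mathcal{K}^0(\operatorname{Spec}_cA)$ is the ring of rational continuous functions on $\operatorname{Spec}_cA$; it satisfies $A\subset\mathcal{K}^0(\operatorname{Spec}_cA)\subset\mathcal{K}(A)$, and $\sum\mathcal{K}^0(\operatorname{Spec}_cA)^2$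 is the set of sums of squares in this ring. *)

(* Defs.v *)
From HB Require Import structures.
From mathcomp Require Import all_boot all_order all_algebra.
From mathcomp Require Import generic_quotient ring_quotient fraction mxpoly ring.
From mathcomp Require Import boolp classical_sets topology.
From mathcomp Require Import ordered_qelim.

Set Implicit Arguments.
Unset Strict Implicit.
Unset Printing Implicit Defensive.

Import Order.TTheory GRing.Theory Num.Theory.

Local Open Scope classical_set_scope.
Local Open Scope ring_scope.
Local Open Scope quotient_scope.

Definition contains_rat (B : comNzRingType) : Prop :=
  exists phi : {rmorphism rat -> B}, injective phi.

Definition formally_real (F : fieldType) : Prop :=
  ~ exists s : seq F, \sum_(x <- s) x ^+ 2 = -1.

Record is_cone (B : comNzRingType) (P : set B) : Prop := IsCone {
  coneD : forall a b, P a -> P b -> P (a + b);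
  coneM : forall a b, P a -> P b -> P (a * b);
  cone_sqr : forall b, P (b ^+ 2) }.

Record is_ordering (B : comNzRingType) (P : set B) : Prop := IsOrdering {
  ordering_cone : is_cone P;
  ordering_proper : ~ P (-1);
  ordering_prime : forall a b, P (a * b) -> P a \/ P (- b) }.

Record rspec (B : comNzRingType) : Type := RSpec {
  rcone :> B -> Prop;
  rconeP : is_ordering rcone }.

HB.instance Definition _ (B : comNzRingType) := gen_eqMixin (rspec B).
HB.instance Definition _ (B : comNzRingType) := gen_choiceMixin (rspec B).

Section Orderings.
Variables (B : comNzRingType) (P : rspec B).

Lemma rconeD a b : P a -> P b -> P (a + b).
Proof. exact: (coneD (ordering_cone (rconeP P))). Qed.

Lemma rconeM a b : P a -> P b -> P (a * b).
Proof. exact: (coneM (ordering_cone (rconeP P))). Qed.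

Lemma rcone_sqr b : P (b ^+ 2).
Proof. exact: (cone_sqr (ordering_cone (rconeP P))). Qed.

Lemma rconeN1 : ~ P (-1).
Proof. exact: (ordering_proper (rconeP P)). Qed.

Lemma rcone_prime a b : P (a * b) -> P a \/ P (- b).
Proof. exact: (ordering_prime (rconeP P)). Qed.

Lemma rcone0 : P 0.
Proof. by have := rcone_sqr 0; rewrite expr0n. Qed.

Lemma rcone_total a : P a \/ P (- a).
Proof. by apply: rcone_prime; rewrite -expr2; apply: rcone_sqr. Qed.

Definition rsupp : {pred B} := fun a => `[< P a /\ P (- a) >].

Lemma rsuppP a : reflect (P a /\ P (- a)) (a \in rsupp).
Proof. exact: asboolP. Qed.

Lemma rsupp_idealr : idealr_closed rsupp.
Proof.
split.
- by apply/rsuppP; rewrite oppr0; split; apply: rcone0.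
- by apply/negP => /rsuppP[_ /rconeN1].
move=> a u v /rsuppP[Pu PNu] /rsuppP[Pv PNv]; apply/rsuppP; rewrite opprD.
case: (rcone_total a) => Pa.
  by split; apply: rconeD; rewrite // -?mulrN; apply: rconeM.
split; apply: rconeD => //; last by rewrite -mulNr; apply: rconeM.
by rewrite -mulrNN; apply: rconeM.
Qed.

Lemma rsupp_prime : prime_idealr_closed rsupp.
Proof.
move=> u v /rsuppP[Puv PNuv].
have [Pu|nPu] := pselect (P u); last first.
  have [//|PNv] := rcone_prime Puv.
  move: PNuv; rewrite -mulrN => /rcone_prime[//|]; rewrite opprK => Pv.
  by apply/orP; right; apply/rsuppP.
have [PNu|nPNu] := pselect (P (- u)).
  by apply/orP; left; apply/rsuppP.
move: PNuv; rewrite -mulNr => /rcone_prime[//|PNv].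
move: Puv; rewrite -mulrNN => /rcone_prime[//|]; rewrite opprK => Pv.
by apply/orP; right; apply/rsuppP.
Qed.

HB.instance Definition _ := isIdealr.Build B rsupp rsupp_idealr.
HB.instance Definition _ := isPrimeIdealrClosed.Build B rsupp rsupp_prime.

Definition rpos (a : B) : Prop := P a /\ a \notin rsupp.

End Orderings.

(** The topology whose basic open sets are
    {alpha | f_1(alpha) > 0, ..., f_k(alpha) > 0}. *)
Section SpectralTopology.
Variable B : comNzRingType.

Definition rbasic (fs : seq B) : set (rspec B) :=
  [set P | {in fs, forall a, rpos P a}].

Lemma rbasic_cover : \bigcup_(U in range rbasic) idfun U = setT.
Proof.
by apply/seteqP; split=> // P _; exists (rbasic [::]) => //; exists [::].
Qed.

Lemma rbasic_join (U V : set (rspec B)) (P : rspec B) :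
    range rbasic U -> range rbasic V -> idfun U P -> idfun V P ->
  exists W, [/\ range rbasic W, idfun W P & idfun W `<=` idfun U `&` idfun V].
Proof.
move=> [fs _ <-] [gs _ <-] Pf Pg; exists (rbasic (fs ++ gs)); split.
- by exists (fs ++ gs).
- by move=> a; rewrite mem_cat => /orP[/Pf|/Pg].
- by move=> Q Qfg; split=> a ain; apply: Qfg; rewrite mem_cat ain ?orbT.
Qed.

HB.instance Definition _ :=
  isBaseTopological.Build (rspec B) rbasic_cover rbasic_join.

End SpectralTopology.

(** [specializes beta alpha] is beta -> alpha. *)
Definition specializes (B : comNzRingType) (beta alpha : rspec B) : Prop :=
  closure [set beta] alpha.

Section Contraction.
Variables (B C : comNzRingType) (phi : {rmorphism B -> C}) (Q : rspec C).

Lemma rcontract_ordering : is_ordering [set b | Q (phi b)].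
Proof.
split; [split|..] => /=.
- by move=> a b; rewrite rmorphD; apply: rconeD.
- by move=> a b; rewrite rmorphM; apply: rconeM.
- by move=> b; rewrite rmorphXn; apply: rcone_sqr.
- by rewrite rmorphN1; apply: rconeN1.
- by move=> a b; rewrite rmorphM rmorphN; apply: rcone_prime.
Qed.

Definition rcontract : rspec B := RSpec rcontract_ordering.

End Contraction.

(** The central real spectrum; contracting along A -> K(A) identifies the
    orderings of K(A) with those of A with support (0). *)
Definition rspec_c (A : idomainType) : set (rspec A) :=
  closure (range (rcontract (@FracField.tofrac A))).
Arguments rspec_c : clear implicits.

Lemma fractionP (D : idomainType) (x : {fraction D}) :
  exists n d, d != 0 /\ x = FracField.tofrac n / FracField.tofrac d.
Proof.
elim/quotW: x => r; exists (frac r).1, (frac r).2.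
have d0 := denom_ratioP r; split=> //.
have td0 : FracField.tofrac (frac r).2 != 0 by rewrite tofrac_eq0.
apply: (mulIf td0); rewrite divfK //; unlock FracField.tofrac.
rewrite -[LHS]FracField.pi_mul; apply/eqmodP => /=.
rewrite FracField.equivfE /FracField.mulf !numden_Ratio ?oner_neq0 //.
  by rewrite !mulr1 mulrC.
all: by rewrite ?mulr1.
Qed.

(** A prime ideal I of B is an instance of [prime_idealr B]; the quotient B/I
    gets its domain structure by choosing inverses classically. *)
Section ResidueField.
Variables (B : comNzRingType) (I : prime_idealr B).

Definition quot_dom : Type := {ideal_quot I}.
HB.instance Definition _ := GRing.ComNzRing.on quot_dom.

Definition quot_unit : {pred quot_dom} := fun x => `[< exists y, y * x = 1 >].
Definition quot_inv (x : quot_dom) : quot_dom :=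
  if pselect (exists y, y * x = 1) is left h then projT1 (cid h) else x.

Lemma quot_mulVx : {in quot_unit, left_inverse 1 quot_inv *%R}.
Proof.
by move=> x /asboolP ux; rewrite /quot_inv; case: pselect => // h; case: cid.
Qed.

Lemma quot_unitPl (x y : quot_dom) : y * x = 1 -> quot_unit x.
Proof. by move=> yx; apply/asboolP; exists y. Qed.

Lemma quot_invr_out : {in [predC quot_unit], quot_inv =1 id}.
Proof.
move=> x /negP nux; rewrite /quot_inv; case: pselect => // h.
by case: nux; apply/asboolP.
Qed.

HB.instance Definition _ := GRing.ComNzRing_hasMulInverse.Build quot_dom
  quot_mulVx quot_unitPl quot_invr_out.

Lemma quot_integral : GRing.integral_domain_axiom quot_dom.
Proof. exact: (@Quotient.rquot_IdomainAxiom B I). Qed.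

HB.instance Definition _ :=
  GRing.ComUnitRing_isIntegral.Build quot_dom quot_integral.

Definition quot_proj (b : B) : quot_dom := \pi_{ideal_quot I} b.

Lemma quot_proj_is_zmod_morphism : zmod_morphism quot_proj.
Proof. exact: (rmorphB (\pi_{ideal_quot I})). Qed.

Lemma quot_proj_is_monoid_morphism : monoid_morphism quot_proj.
Proof.
by split; [exact: (rmorph1 (\pi_{ideal_quot I}))
          |exact: (rmorphM (\pi_{ideal_quot I}))].
Qed.

HB.instance Definition _ :=
  GRing.isZmodMorphism.Build B quot_dom quot_proj quot_proj_is_zmod_morphism.
HB.instance Definition _ :=
  GRing.isMonoidMorphism.Build B quot_dom quot_proj quot_proj_is_monoid_morphism.

(** For a maximal ideal I, B/I is already a field and B/I -> Frac (B/I) is an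
    isomorphism. *)
Definition residue_field : fieldType := {fraction quot_dom}.

Definition residue_map : {rmorphism B -> residue_field} :=
  @FracField.tofrac quot_dom \o quot_proj.

Lemma residue_map_eq0 b : (residue_map b == 0) = (b \in I).
Proof.
by rewrite /= tofrac_eq0 -[b in RHS]subr0 Quotient.idealrBE rmorph0.
Qed.

Lemma residue_fieldP (x : residue_field) :
  exists a b, b \notin I /\ x = residue_map a / residue_map b.
Proof.
have [n [d [d0 ->]]] := fractionP x; exists (repr n), (repr d).
have projE (q : quot_dom) : quot_proj (repr q) = q by exact: reprK.
by rewrite -residue_map_eq0 /= !projE tofrac_eq0 d0.
Qed.

End ResidueField.

Section ResidueOrdering.
Variables (B : comNzRingType) (P : rspec B).
Local Notation k := (residue_field (rsupp P)).
Local Notation pi := (residue_map (rsupp P)).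

Definition residue_cone : set k :=
  [set x | exists a b, [/\ b \notin rsupp P, P (a * b) & x = pi a / pi b]].

Lemma rcone_supp a b : a - b \in rsupp P -> P b -> P a.
Proof. by move=> /rsuppP[Pab _] Pb; rewrite -(subrK b a); apply: rconeD. Qed.

Lemma residue_coneE a b : b \notin rsupp P -> residue_cone (pi a / pi b) <-> P (a * b).
Proof.
move=> nSb; split; last by move=> Pab; exists a, b.
move=> [e [f [nSf Pef /eqP]]].
rewrite eqr_div ?residue_map_eq0 // -!rmorphM -subr_eq0 -rmorphB residue_map_eq0.
move=> Safeb; have Pabf : P (a * b * f ^+ 2).
  apply: (@rcone_supp _ ((e * f) * b ^+ 2)).
    have -> : a * b * f ^+ 2 - e * f * b ^+ 2 = (b * f) * (a * f - e * b) by ring.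
    exact: idealMr.
  by apply: rconeM => //; apply: rcone_sqr.
have [//|PNf2] := rcone_prime Pabf; case/negP: nSf.
rewrite -[f \in _]orbb -prime_idealrM -expr2; apply/rsuppP; split=> //.
exact: rcone_sqr.
Qed.

Lemma residue_cone_ordering : is_ordering residue_cone.
Proof.
have nSM b d : b \notin rsupp P -> d \notin rsupp P -> b * d \notin rsupp P.
  by move=> nSb nSd; rewrite prime_idealrM negb_or nSb.
have nz b : b \notin rsupp P -> pi b != 0 by rewrite residue_map_eq0.
split; [split|..].
- move=> _ _ [a [b [nSb Pab ->]]] [c [d [nSd Pcd ->]]].
  rewrite addf_div ?nz // -!rmorphM -rmorphD; apply/residue_coneE; first exact: nSM.
  have -> : (a * d + c * b) * (b * d) = (a * b) * d ^+ 2 + (c * d) * b ^+ 2 by ring.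
  by apply: rconeD; apply: rconeM => //; apply: rcone_sqr.
- move=> _ _ [a [b [nSb Pab ->]]] [c [d [nSd Pcd ->]]].
  rewrite mulf_div -!rmorphM; apply/residue_coneE; first exact: nSM.
  by rewrite mulrACA; apply: rconeM.
- move=> x; have [a [b [nSb ->]]] := residue_fieldP x.
  rewrite expr_div_n -!rmorphXn; apply/residue_coneE; first exact: nSM.
  by rewrite -exprMn; apply: rcone_sqr.
- have -> : -1 = pi (-1) / pi 1 :> k by rewrite rmorphN rmorph1 divr1.
  rewrite residue_coneE ?mulr1; first exact: rconeN1.
  by rewrite (idealr1 (rsupp P)).
- move=> x y; have [a [b [nSb ->]]] := residue_fieldP x.
  have [c [d [nSd ->]]] := residue_fieldP y.
  rewrite mulf_div -!rmorphM residue_coneE ?nSM // mulrACA => /rcone_prime[Pab|Ncd].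
    by left; apply/residue_coneE.
  by right; rewrite -mulNr -rmorphN; apply/residue_coneE; rewrite ?mulNr.
Qed.

Definition residue_ordering : rspec k := RSpec residue_cone_ordering.

End ResidueOrdering.

(** Real closures are unique up to a unique isomorphism over F, so they are given
    by their defining property rather than constructed. *)
Record real_closure (F : fieldType) (Q : rspec F) : Type := RealClosure {
  rc_field :> rcfType;
  rc_emb : {rmorphism F -> rc_field};
  rc_emb_ge0 : forall x, 0 <= rc_emb x <-> Q x;
  rc_algebraic : forall y, algebraicOver rc_emb y }.

Definition rc_family (A : comNzRingType) : Type :=
  forall alpha : rspec A, real_closure (residue_ordering alpha).

Section Evaluation.
Variables (A : comNzRingType) (R : rc_family A).

(** [rval R alpha a] is a(alpha). *)
Definition rval (alpha : rspec A) : {rmorphism A -> R alpha} :=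
  rc_emb (R alpha) \o residue_map (rsupp alpha).

Lemma rval_ge0 alpha a : 0 <= rval alpha a <-> alpha a.
Proof.
rewrite -[alpha a]/(rcone alpha a) -{2}[a]mulr1 -residue_coneE; last first.
  by rewrite (idealr1 (rsupp alpha)).
by rewrite rmorph1 divr1; apply: rc_emb_ge0.
Qed.

Lemma rval_eq0 alpha a : (rval alpha a == 0) = (a \in rsupp alpha).
Proof. by rewrite /= fmorph_eq0 residue_map_eq0. Qed.

Section Place.
Variables (beta alpha : rspec A).

(** [hull] is W_{beta alpha}, packaged as the ring [valring], with maximal ideal
    [valmax] (its non-units). It is a subring of [R beta] even when beta does not
    specialize to alpha: if s(beta) = 0 the bound a(beta)/s(beta) is 0. *)
Definition hull : {pred R beta} := fun z =>
  `[< exists a s, s \notin rsupp alpha /\ `|z| <= rval beta a / rval beta s >].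

Lemma hull_subring : subring_closed hull.
Proof.
have nS1 : 1 \notin rsupp alpha by rewrite (idealr1 (rsupp alpha)).
have nSM s t : s \notin rsupp alpha -> t \notin rsupp alpha ->
    s * t \notin rsupp alpha.
  by move=> nSs nSt; rewrite prime_idealrM negb_or nSs.
split.
- apply/asboolP; exists 1, 1; split => //.
  by rewrite normr1 !rmorph1 divr1.
- move=> x y /asboolP[a [s [nSs lex]]] /asboolP[b [t [nSt ley]]].
  apply/asboolP.
  have [s0|s0] := eqVneq (rval beta s) 0.
    move: lex; rewrite s0 invr0 mulr0 normr_le0 => /eqP ->.
    by exists b, t; rewrite sub0r normrN.
  have [t0|t0] := eqVneq (rval beta t) 0.
    move: ley; rewrite t0 invr0 mulr0 normr_le0 => /eqP ->.
    by exists a, s; rewrite subr0.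
  exists (a * t + b * s), (s * t); split; first exact: nSM.
  rewrite rmorphD !rmorphM -addf_div //.
  by apply: le_trans (ler_normB _ _) _; apply: lerD.
- move=> x y /asboolP[a [s [nSs lex]]] /asboolP[b [t [nSt ley]]].
  apply/asboolP; exists (a * b), (s * t); split; first exact: nSM.
  by rewrite normrM !rmorphM -mulf_div ler_pM.
Qed.

HB.instance Definition _ := GRing.isSubringClosed.Build (R beta) hull hull_subring.

Record valring : Type := ValRing { valring_val :> R beta; _ : valring_val \in hull }.

HB.instance Definition _ := [isSub for valring_val].
HB.instance Definition _ := [Choice of valring by <:].
HB.instance Definition _ := [SubChoice_isSubComNzRing of valring by <:].

Lemma hull_le x y : `|x| <= `|y| -> y \in hull -> x \in hull.
Proof.
move=> lexy /asboolP[a [s [nSs ley]]]; apply/asboolP; exists a, s; split=> //.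
exact: le_trans ley.
Qed.

Definition valmax : {pred valring} := fun w => `[< ~ exists v, v * w = 1 >].

Lemma valmaxP w : reflect (val w = 0 \/ (val w)^-1 \notin hull) (w \in valmax).
Proof.
have nuP : reflect (~ exists v, v * w = 1) (w \in valmax) by exact: asboolP.
apply: (iffP nuP) => [nuw|].
  have [|w0] := eqVneq (val w) 0; first by left.
  right; apply/negP => iw; apply: nuw; exists (ValRing iw).
  by apply: val_inj; rewrite /= mulVf.
move=> h [v vwE]; have {}vwE : val v * val w = 1 := congr1 val vwE.
case: h => [w0|/negP[]].
  by move/eqP: vwE; rewrite w0 mulr0 eq_sym oner_eq0.
have w0 : val w != 0.
  by apply: contra_eq_neq vwE => ->; rewrite mulr0 eq_sym oner_neq0.
have <- : val v = (val w)^-1 by apply: (mulIf w0); rewrite vwE mulVf.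
exact: valP.
Qed.

Lemma valmax_idealr : idealr_closed valmax.
Proof.
have mulI (c w : valring) : w \in valmax -> c * w \in valmax.
  move=> /asboolP nuw; apply/asboolP => -[v vcw]; apply: nuw.
  by exists (v * c); rewrite -mulrA.
have addI (u v : valring) : `|val u| <= `|val v| ->
    v \in valmax -> u + v \in valmax.
  move=> leuv /valmaxP[v0|nVv].
    move: (leuv); rewrite v0 normr0 normr_le0 => /eqP u0.
    by apply/valmaxP; left; rewrite rmorphD /= u0 v0 addr0.
  have v0 : val v != 0.
    by apply: contraNneq nVv => ->; rewrite invr0 rpred0.
  have huv : val u / val v \in hull.
    apply: (@hull_le _ 1); last exact: rpred1.
    by rewrite normr1 normf_div ler_pdivrMr ?normr_gt0 // mul1r.
  have -> : u + v = (ValRing huv + 1) * v.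
    by apply: val_inj => /=; rewrite mulrDl mul1r divfK.
  by apply: mulI; apply/valmaxP; right.
split.
- by apply/valmaxP; left; rewrite rmorph0.
- by apply/asboolP => -[]; exists 1; rewrite mulr1.
- move=> c u v /(mulI c) cu vm.
  have [le|/ltW le] := leP `|val (c * u)| `|val v|; first exact: addI.
  by rewrite addrC; apply: addI.
Qed.

Lemma valmax_prime : prime_idealr_closed valmax.
Proof.
move=> u v /asboolP nuuv.
have [[u' uu']|] := pselect (exists w, w * u = 1); last first.
  by move=> nu; apply/orP; left; apply/asboolP.
have [[v' vv']|] := pselect (exists w, w * v = 1); last first.
  by move=> nu; apply/orP; right; apply/asboolP.
by case: nuuv; exists (u' * v'); rewrite mulrACA uu' vv' mulr1.
Qed.

HB.instance Definition _ := isIdealr.Build valring valmax valmax_idealr.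
HB.instance Definition _ := isPrimeIdealrClosed.Build valring valmax valmax_prime.

Lemma rval_hull a : rval beta a \in hull.
Proof.
have nS1 : 1 \notin rsupp alpha by rewrite (idealr1 (rsupp alpha)).
apply/asboolP; have [a0|/ltW a0] := leP 0 (rval beta a).
  by exists a, 1; rewrite rmorph1 divr1 ger0_norm.
by exists (- a), 1; rewrite rmorph1 divr1 rmorphN ler0_norm.
Qed.

Definition rval_valring (a : A) : valring := ValRing (rval_hull a).

Definition place_field : fieldType := residue_field valmax.
Definition place : {rmorphism valring -> place_field} := residue_map valmax.

(** An inclusion of [R alpha] in the residue field of W_{beta alpha} extending
    a(alpha) |-> lambda(a(beta)). When beta specializes to alpha there is exactly
    one: the residue field is real closed and [R alpha] is algebraic over
    k(supp alpha). *)
Record place_embedding : Type := PlaceEmbedding {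
  place_emb :> {rmorphism R alpha -> place_field};
  place_embE : forall a, place_emb (rval alpha a) = place (rval_valring a) }.

End Place.

Definition place_family : Type :=
  forall beta alpha : rspec A, specializes beta alpha -> place_embedding beta alpha.

End Evaluation.

Section MapFormula.
Variables (T U : Type) (h : T -> U).

Fixpoint map_term (t : GRing.term T) : GRing.term U :=
  match t with
  | GRing.Var i => GRing.Var U i
  | GRing.Const x => GRing.Const (h x)
  | GRing.NatConst n => GRing.NatConst U n
  | GRing.Add t1 t2 => GRing.Add (map_term t1) (map_term t2)
  | GRing.Opp t1 => GRing.Opp (map_term t1)
  | GRing.NatMul t1 n => GRing.NatMul (map_term t1) n
  | GRing.Mul t1 t2 => GRing.Mul (map_term t1) (map_term t2)
  | GRing.Inv t1 => GRing.Inv (map_term t1)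
  | GRing.Exp t1 n => GRing.Exp (map_term t1) n
  end.

Fixpoint map_formula (f : ord.formula T) : ord.formula U :=
  match f with
  | ord.Bool b => ord.Bool b
  | ord.Equal t1 t2 => ord.Equal (map_term t1) (map_term t2)
  | ord.Lt t1 t2 => ord.Lt (map_term t1) (map_term t2)
  | ord.Le t1 t2 => ord.Le (map_term t1) (map_term t2)
  | ord.Unit t1 => ord.Unit (map_term t1)
  | ord.And f1 f2 => ord.And (map_formula f1) (map_formula f2)
  | ord.Or f1 f2 => ord.Or (map_formula f1) (map_formula f2)
  | ord.Implies f1 f2 => ord.Implies (map_formula f1) (map_formula f2)
  | ord.Not f1 => ord.Not (map_formula f1)
  | ord.Exists i f1 => ord.Exists i (map_formula f1)
  | ord.Forall i f1 => ord.Forall i (map_formula f1)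
  end.

End MapFormula.

Section RationalContinuous.
Variables (A : idomainType) (R : rc_family A) (j : place_family R).

Definition central_fun : Type := forall alpha : rspec_c A, R (val alpha).

Implicit Types g : central_fun.

(** The graph of g is defined by a single formula with parameters in A, whose
    free variable is 'X_0 (any other free variable is read as 0). *)
Definition semialgebraic g : Prop :=
  exists phi : ord.formula A, forall (alpha : rspec_c A) (x : R (val alpha)),
    ord.holds [:: x] (map_formula (rval R (val alpha)) phi) <-> x = g alpha.

Definition central_continuous g : Prop :=
  forall (beta alpha : rspec_c A) (h : specializes (val beta) (val alpha)),
  exists2 w : valring R (val beta) (val alpha),
    valring_val w = g beta &
      place R (val beta) (val alpha) w = j h (g alpha).

Definition rational g : Prop :=
  exists p q : A, q != 0 /\ forall alpha : rspec_c A,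
    rval R (val alpha) q != 0 ->
    g alpha = rval R (val alpha) p / rval R (val alpha) q.

Definition rational_continuous g : Prop :=
  [/\ semialgebraic g, central_continuous g & rational g].

(** An element f of A is seen in K^0(Spec_c A) as alpha |-> f(alpha), and the
    ring operations of K^0(Spec_c A) are pointwise. *)
Definition sos_rational_continuous : set A :=
  [set f | exists (n : nat) (g : 'I_n -> central_fun),
    (forall i, rational_continuous (g i)) /\
    forall alpha : rspec_c A,
      rval R (val alpha) f = \sum_(i < n) g i alpha ^+ 2].

End RationalContinuous.

(* Main.v *)
Require Import Defs.
From HB Require Import structures.
From mathcomp Require Import all_boot all_order all_algebra.
From mathcomp Require Import fraction boolp classical_sets topology.
From mathcomp Require Import ordered_qelim ring lra.

Import Order.TTheory GRing.Theory Num.Theory.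

Local Open Scope classical_set_scope.
Local Open Scope ring_scope.

(** The nonnegativity of [f] on the whole real spectrum has an algebraic
    certificate: [f p = D] with [D = f^2m + q], where [p] and [q] are sums of
    squares in [A] ([nonneg_certificate], the abstract Positivstellensatz).
    Multiplying by [f D] gives [f D^2 = f^2 p D], and the right-hand side is a
    sum of squares [\sum_i N_i^2] because [p] and [D] are.  Hence
    [f = \sum_i (N_i / D)^2] wherever [D] does not vanish.

    This denominator is a good one: at a point where [D] vanishes, the two
    nonnegative terms [f^2m] and [q] vanish, hence so does [f].  With the
    convention [x / 0 = 0] the functions [g_i = N_i / D] are therefore defined
    everywhere, the identity [f = \sum_i g_i^2] holds everywhere, and
    [g_i^2 <= f].  This bound is what makes [g_i] continuous at the zeros of [D]
    ([central_quot_continuous]): there [f] has place 0, and an element of a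
    convex valuation ring whose square is at most an infinitesimal is itself
    infinitesimal.  Away from the zeros of [D] the place is compatible with
    division, so continuity is automatic.

    That the fraction field is formally real gives [D != 0] in [A] when
    [f != 0], so that the [g_i] are rational functions.

    The certificate comes from Zorn's lemma: without one, the cone generated by
    [- f] contains no [- f^2m], and a cone maximal with this property is an
    ordering at which [f] is negative. *)

(** * Cones, orderings and the Positivstellensatz *)

Section Cones.
Context {B : comNzRingType}.
Implicit Types (P T : set B) (a b s x : B).

Definition sos : set B := [set x | exists s : seq B, x = \sum_(y <- s) y ^+ 2].

Lemma sos_cone : is_cone sos.
Proof.
split.
- by move=> _ _ [s ->] [t ->]; exists (s ++ t); rewrite big_cat.
- move=> _ _ [s ->] [t ->]; exists [seq x * y | x <- s, y <- t].
  rewrite big_allpairs_dep big_distrl; apply: eq_bigr => x _.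
  by rewrite big_distrr; apply: eq_bigr => y _; rewrite exprMn.
- by move=> b; exists [:: b]; rewrite big_seq1.
Qed.

Lemma cone_0 {P} : is_cone P -> P 0.
Proof. by move=> /cone_sqr /(_ 0); rewrite expr0n. Qed.

Lemma cone_1 {P} : is_cone P -> P 1.
Proof. by move=> /cone_sqr /(_ 1); rewrite expr1n. Qed.

(** The cone generated by [P] and [a], when [P] is a cone: squares lie in [P], so
    higher powers of [a] contribute nothing new. *)
Definition adjoin P a : set B :=
  [set x | exists p q, [/\ P p, P q & x = p + a * q]].

Lemma sub_adjoin {P} a : is_cone P -> P `<=` adjoin P a.
Proof.
by move=> /cone_0 P0 p Pp; exists p, 0; split; rewrite ?mulr0 ?addr0.
Qed.

Lemma mem_adjoin {P} a : is_cone P -> adjoin P a a.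
Proof.
move=> cP; exists 0, 1; split; [exact: cone_0|exact: cone_1|].
by rewrite add0r mulr1.
Qed.

Lemma adjoin_cone {P} a : is_cone P -> is_cone (adjoin P a).
Proof.
move=> cP; have [PD PM Psqr] := cP; split.
- move=> _ _ [p [q [Pp Pq ->]]] [p' [q' [Pp' Pq' ->]]].
  by exists (p + p'), (q + q'); split; [exact: PD|exact: PD|ring].
- move=> _ _ [p [q [Pp Pq ->]]] [p' [q' [Pp' Pq' ->]]].
  exists (p * p' + a ^+ 2 * (q * q')), (p * q' + q * p').
  by split; [apply: (PD)|apply: (PD)|ring]; apply: (PM) => //; apply: (PM).
- by move=> b; apply: sub_adjoin.
Qed.

(** For a cone [P] this says that [-1] is not in the cone generated by [P] in the
    localization at [s]; an ordering avoids [s] when [s] does not vanish at it. *)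
Definition avoids s P : Prop := forall m : nat, ~ P (- (s ^+ m) ^+ 2).

Lemma maximal_avoiding_cone {s T} : is_cone T -> avoids s T ->
  exists P, [/\ is_cone P, T `<=` P, avoids s P &
    forall Q, is_cone Q -> avoids s Q -> P `<=` Q -> Q `<=` P].
Proof.
move=> cT nT.
pose good P := [/\ is_cone P, T `<=` P & avoids s P].
(* The union of the empty chain is empty, hence not a cone. *)
have [F FP Ftot|P [gP maxP]] := @Zorn_bigcup _ [set P | P = set0 \/ good P].
  have [[X FX [x Xx]]|noX] := pselect (exists2 X, F X & X !=set0); last first.
    left; apply/seteqP; split=> // x [X FX Xx]; apply: noX.
    by exists X => //; exists x.
  have gF Y y : F Y -> Y y -> good Y.
    by move=> FY Yy; have [Y0|//] := FP Y FY; rewrite Y0 in Yy.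
  have gX := gF X x FX Xx; right; split; first split.
  - move=> a b [Y FY Ya] [Z FZ Zb]; have [YZ|ZY] := Ftot Y Z FY FZ.
      exists Z => //; have [cZ _ _] := gF Z b FZ Zb.
      by apply: (coneD cZ) => //; apply: YZ.
    exists Y => //; have [cY _ _] := gF Y a FY Ya.
    by apply: (coneD cY) => //; apply: ZY.
  - move=> a b [Y FY Ya] [Z FZ Zb]; have [YZ|ZY] := Ftot Y Z FY FZ.
      exists Z => //; have [cZ _ _] := gF Z b FZ Zb.
      by apply: (coneM cZ) => //; apply: YZ.
    exists Y => //; have [cY _ _] := gF Y a FY Ya.
    by apply: (coneM cY) => //; apply: ZY.
  - by move=> b; exists X => //; have [cX _ _] := gX; apply: (cone_sqr cX).
  - by move=> t Tt; exists X => //; have [_ TX _] := gX; apply: TX.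
  - by move=> m [Y FY Ym]; have [_ _ nY] := gF Y _ FY Ym; apply: (nY m).
have {}gP : good P.
  case: gP => // P0; exfalso; apply: (maxP T); last by right; split.
  by rewrite P0; split=> // /(_ 0 (cone_0 cT)).
have [cP TP nP] := gP; exists P; split=> // Q cQ nQ PQ.
apply: contrapT => nQP; apply: (maxP Q) => //.
by right; split=> //; apply: subset_trans PQ.
Qed.

(** If neither [a] nor [- b] lies in [P], adjoining each of them produces some
    [- s^2m = p + a q] and [- s^2n = p' - b q'].  Multiplying [a q] by [- b q'] and
    solving for [- s^2(m+n)] expresses the latter with coefficients in [P] and the
    product [a b], so that [a b] cannot lie in [P] either. *)
Lemma maximal_avoiding_ordering {s P} : is_cone P -> avoids s P ->
    (forall Q, is_cone Q -> avoids s Q -> P `<=` Q -> Q `<=` P) ->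
  is_ordering P.
Proof.
move=> cP nP maxP; have [PD PM Psqr] := cP.
have escape a : ~ P a -> exists m p q, [/\ P p, P q & - (s ^+ m) ^+ 2 = p + a * q].
  move=> nPa; apply: contrapT => noesc; apply: nPa.
  apply: (maxP (adjoin P a)); [exact: adjoin_cone| |exact: sub_adjoin|exact: mem_adjoin].
  by move=> m [p [q [Pp Pq E]]]; apply: noesc; exists m, p, q.
split=> //; first by move=> P1; apply: (nP 0%N); rewrite expr0 expr1n.
move=> a b Pab; have [|/escape[m [p [q [Pp Pq Em]]]]] := pselect (P a); first by left.
have [|/escape[n [p' [q' [Pp' Pq' En]]]]] := pselect (P (- b)); first by right.
exfalso; apply: (nP (m + n)%N).
have -> : - (s ^+ (m + n)) ^+ 2 =
    (s ^+ m) ^+ 2 * p' + p * (s ^+ n) ^+ 2 + p * p' + a * b * (q * q').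
  have -> : a * b * (q * q') = - ((a * q) * (- b * q')) by ring.
  have -> : a * q = - (s ^+ m) ^+ 2 - p by rewrite Em; ring.
  have -> : - b * q' = - (s ^+ n) ^+ 2 - p' by rewrite En; ring.
  by rewrite exprD; ring.
by do ![apply: (PD)]; apply: (PM) => //; apply: (PM).
Qed.

Lemma exists_avoiding_ordering {s T} : is_cone T -> avoids s T ->
  exists P : rspec B, T `<=` P /\ avoids s P.
Proof.
move=> cT nT; have [P [cP TP nP maxP]] := maximal_avoiding_cone cT nT.
by exists (RSpec (maximal_avoiding_ordering cP nP maxP)).
Qed.

(** An ordering that contains [f] and [- f] also contains their product [- f^2]; so
    the cone generated by [- f] must contain some [- f^2m]. *)
Lemma nonneg_certificate f : (forall P : rspec B, P f) ->
  exists m p q, [/\ sos p, sos q & f * p = (f ^+ m) ^+ 2 + q].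
Proof.
move=> f_ge0; apply: contrapT => nocert.
have [|P [TP nP]] := @exists_avoiding_ordering f _ (adjoin_cone (- f) sos_cone).
  move=> m [q [p [Sq Sp E]]]; apply: nocert; exists m, p, q; split=> //.
  by rewrite -[(f ^+ m) ^+ 2]opprK E; ring.
apply: (nP 1%N); rewrite expr1 expr2 -mulNr.
by apply: rconeM (f_ge0 P); apply: TP; apply: mem_adjoin _ sos_cone.
Qed.

End Cones.

(** Dividing by [a^2] would write [-1] as a sum of squares of fractions. *)
Lemma formally_real_sqrD_eq0 {A : idomainType} (a q : A) :
  formally_real {fraction A} -> sos q -> a ^+ 2 + q = 0 -> a = 0.
Proof.
move=> rK [s ->] E; apply: contrapT => /eqP a0; apply: rK.
have ta0 : FracField.tofrac a != 0 by rewrite tofrac_eq0.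
exists [seq FracField.tofrac y / FracField.tofrac a | y <- s].
rewrite big_map; under eq_bigr do rewrite expr_div_n -rmorphXn.
rewrite -mulr_suml -rmorph_sum /=.
have -> : \sum_(y <- s) y ^+ 2 = - a ^+ 2 by apply/eqP; rewrite -addr_eq0 addrC E.
by rewrite rmorphN rmorphXn mulNr divff // expf_neq0.
Qed.

(** * Quotients as functions on the central spectrum *)

Section Quotients.
Context {A : idomainType} {R : rc_family A} (j : place_family R).
Implicit Types (N D f : A).

Lemma rval_sos_ge0 q (alpha : rspec A) : sos q -> 0 <= rval R alpha q.
Proof.
move=> [s ->]; rewrite rmorph_sum; apply: sumr_ge0 => y _.
by rewrite rmorphXn sqr_ge0.
Qed.

(** At the zeros of [D] the value is 0, by the convention [x / 0 = 0]. *)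
Definition central_quot N D : central_fun R := fun alpha =>
  rval R (val alpha) N / rval R (val alpha) D.

(** Being nonzero is an open condition: up to sign, [D] is positive at [alpha]. *)
Lemma specializes_rval_neq0 {beta alpha : rspec A} D :
  specializes beta alpha -> rval R alpha D != 0 -> rval R beta D != 0.
Proof.
move=> ba; rewrite !rval_eq0.
wlog Da : D / alpha D.
  move=> h; have [/h//|Nin] := rcone_total alpha D.
  by move=> DN; have := h _ Nin; rewrite !rpredN; apply.
move=> nDa; have : nbhs alpha (rbasic [:: D]).
  rewrite nbhsE; exists (rbasic [:: D]); last by [].
  split; last by move=> a; rewrite inE => /eqP ->; split.
  exists [set rbasic [:: D]]; first by move=> _ ->; exists [:: D].
  by rewrite bigcup_set1.
move=> /ba [_ [->]] /(_ D); rewrite inE eqxx => /(_ isT).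
by case.
Qed.

(** The maximal ideal of a convex valuation ring is convex, and it is prime. *)
Lemma valmax_sqr_le {beta alpha : rspec A} (u v : valring R beta alpha) :
  val u ^+ 2 <= val v -> v \in valmax (alpha := alpha) ->
  u \in valmax (alpha := alpha).
Proof.
move=> uv vm; rewrite -[u \in _]orbb -prime_idealrM -expr2.
have v_ge0 : 0 <= val v by apply: le_trans uv; apply: sqr_ge0.
move: vm => /valmaxP [v0|nv]; apply/valmaxP; rewrite rmorphXn /=.
  by left; apply/eqP; rewrite eq_le sqr_ge0 andbT -[leRHS]v0.
have [u0|u0] := eqVneq (val u) 0; [by left; rewrite u0 expr0n|right].
apply: contraNN nv; apply: hull_le.
have u2 : 0 < val u ^+ 2 by rewrite exprn_even_gt0.
by rewrite !ger0_norm ?invr_ge0 ?sqr_ge0 // lef_pV2 // posrE (lt_le_trans u2).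
Qed.

(** For a specialization from [beta] to [alpha] with [D(alpha) = 0], the bound by [f]
    forces the place of the quotient at [beta] to be 0, the value at [alpha];
    otherwise [D(beta)] is a unit of the valuation ring and the place commutes with
    the quotient. *)
Lemma central_quot_continuous N D f :
    (forall alpha : rspec A, rval R alpha D = 0 -> rval R alpha f = 0) ->
    (forall alpha : rspec A,
      (rval R alpha N / rval R alpha D) ^+ 2 <= rval R alpha f) ->
  central_continuous j (central_quot N D).
Proof.
move=> Df gf beta alpha h.
set b := val beta; set a := val alpha.
have gin : central_quot N D beta \in hull a.
  apply: (@hull_le _ _ _ _ _ (rval R b (1 + f))); last exact: rval_hull.
  (* [x^2 <= y] implies [|x| <= 1 + y], which bounds the quotient by an element
     of [A]. *)
  have := gf b; rewrite rmorphD rmorph1 -/(central_quot N D beta).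
  move: (central_quot N D beta) (rval R b f) => x y xy.
  have y0 : 0 <= y by apply: le_trans xy; apply: sqr_ge0.
  rewrite [`|1 + y|]ger0_norm; last by apply: addr_ge0.
  have x2 : `|x| ^+ 2 = x ^+ 2 by rewrite real_normK ?num_real.
  by have := normr_ge0 x; have := sqr_ge0 (`|x| - 1); nra.
exists (ValRing gin) => //.
have [D0|D0] := eqVneq (rval R a D) 0.
  have -> : central_quot N D alpha = 0 by rewrite /central_quot -/a D0 invr0 mulr0.
  rewrite rmorph0; apply/eqP; rewrite residue_map_eq0.
  apply: (@valmax_sqr_le _ _ _ (rval_valring R b a f)); first exact: (gf b).
  by rewrite -residue_map_eq0 -/(place R b a) -(place_embE (j _ _ h)) Df // rmorph0.
have Db := specializes_rval_neq0 D h D0.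
have jD : j _ _ h (rval R a D) != 0 by rewrite fmorph_eq0.
apply: (mulIf jD); rewrite -rmorphM divfK // !place_embE -rmorphM.
by congr (place _ _ _ _); apply: val_inj; rewrite rmorphM /= divfK.
Qed.

Lemma central_quot_semialgebraic N D : semialgebraic (central_quot N D).
Proof.
exists (ord.Equal (GRing.Var A 0)
  (GRing.Mul (GRing.Const N) (GRing.Inv (GRing.Const D)))).
by [].
Qed.

Lemma central_quot_rational N D : D != 0 -> rational (central_quot N D).
Proof. by exists N, D. Qed.

End Quotients.

Theorem theorem6p4 (A : idomainType) (A_rat : contains_rat A)
    (KA_real : formally_real {fraction A})
    (R : rc_family A) (j : place_family R) (f : A)
    (f_ge0 : forall alpha : rspec A, 0 <= rval R alpha f) :
  sos_rational_continuous j f.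
Proof.
(* The certificate may have [D = 0] when [f = 0]; the empty sum serves then. *)
have [->|f0] := eqVneq f 0.
  exists 0%N, (fun _ => central_quot 0 0); split; first by case.
  by move=> alpha; rewrite big_ord0 rmorph0.
have [|m [p [q [Sp Sq E]]]] := @nonneg_certificate A f.
  by move=> P; apply/rval_ge0/f_ge0.
pose D := (f ^+ m) ^+ 2 + q.
have SD : sos D by apply: (coneD sos_cone) => //; apply: (cone_sqr sos_cone).
have D0 : D != 0.
  apply: contraNneq f0 => /(formally_real_sqrD_eq0 _ _ KA_real Sq) /eqP.
  by rewrite expf_eq0 => /andP[].
have Df (alpha : rspec A) : rval R alpha D = 0 -> rval R alpha f = 0.
  rewrite rmorphD rmorphXn => /eqP; rewrite paddr_eq0 ?sqr_ge0 ?rval_sos_ge0 //.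
  move=> /andP[+ _]; rewrite rmorphXn expf_eq0 expf_eq0.
  by move=> /andP[_ /andP[_ /eqP]].
(* [s] lists the numerators. *)
have [s fD2] : sos (f * D ^+ 2).
  have -> : f * D ^+ 2 = f ^+ 2 * p * D by rewrite /D -E; ring.
  apply: (coneM sos_cone) => //; apply: (coneM sos_cone) => //.
  exact: (cone_sqr sos_cone).
have f_sum (alpha : rspec A) :
    rval R alpha f = \sum_(y <- s) (rval R alpha y / rval R alpha D) ^+ 2.
  have [Da|Da] := eqVneq (rval R alpha D) 0.
    rewrite Df // big1 // => y _.
    by rewrite Da invr0 mulr0 expr0n.
  under eq_bigr do rewrite expr_div_n -rmorphXn.
  rewrite -mulr_suml -rmorph_sum -fD2 rmorphM rmorphXn mulfK //.
  by rewrite expf_neq0.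
exists (size s), (fun i => central_quot s`_i D); split; last first.
  by move=> alpha; rewrite f_sum (big_nth 0) big_mkord.
move=> i; split.
- exact: central_quot_semialgebraic.
- apply: (central_quot_continuous _ _ _ f) => // alpha.
  rewrite f_sum (big_nth 0) big_mkord (bigD1 i) //= lerDl.
  by apply: sumr_ge0 => k _; apply: sqr_ge0.
- exact: central_quot_rational.
Qed.
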